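(* Let $\ell>0$, $T>0$, $Q_T=(0,\ell)\times(0,T)$, $\overline{Q}_T=[0,\ell]\times[0,T]$ and $\overline{S}_T=\big([0,\ell]\times\{0\}\big)\cup\big(\{0\}\times[0,T]\big)$. Let $n,m\ge 1$, $0<\alpha_1<\dots<\alpha_n\le 1$, $0<\beta_1<\dots<\beta_m\le 1$, and let $p_i,q_j,r,F\in C(\overline{Q}_T)$ ($1\le i\le n$, $1\le j\le m$) be real-valued with $p_i\ge 0$ and $q_j\ge 0$ in $Q_T$ for all $i,j$, $\sum_{i=1}^n p_i(x,t)>0$ for all $(x,t)\in\overline{Q}_T$, and $r(x,t)\le 0$ for all $(x,t)\in\overline{Q}_T$. Let $u$ be a real-valued function satisfying the regularity conditions $u\in C(\overline{Q}_T)$, $u(\cdot,t)\in W^{1,1}(0,\ell)$ for $t\in(0,T)$, $u(x,\cdot)\in W^{1,1}(0,T)$ for $x\in(0,\ell)$, and the equation $$\sum_{i=1}^n p_i(x,t)\,\partial_t^{\alpha_i}u(x,t)+\sum_{j=1}^m q_j(x,t)\,\partial_x^{\beta_j}u(x,t)=r(x,t)u(x,t)+F(x,t),\qquad (x,t)\in Q_T.$$ (i) If $F(x,t)\le 0$ for all $(x,t)\in\overline{Q}_T$, then $$\max_{\overline{Q}_T}u\le\max\Big\{0,\max_{\overline{S}_T}u\Big\}.$$ (ii) If $F(x,t)\ge 0$ for all $(x,t)\in\overline{Q}_T$, then $$\min_{\overline{Q}_T}u\ge\min\Big\{0,\min_{\overline{S}_T}u\Big\}.$$ Moreover, if $r\equiv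 0$ in $Q_T$, then the conclusion of (i) can be replaced by $\max_{\overline{Q}_T}u=\max_{\overline{S}_T}u$ (when $F\le 0$ on $\overline{Q}_T$), and the conclusion of (ii) by $\min_{\overline{Q}_T}u=\min_{\overline{S}_T}u$ (when $F\ge 0$ on $\overline{Q}_T$).
   Context: For $0<\alpha<1$ the Caputo derivative in time is $\partial_t^{\alpha}u(x,t)=\frac{1}{\Gamma(1-\alpha)}\int_0^t(t-s)^{-\alpha}\frac{\partial}{\partial s}u(x,s)\,ds$; for $0<\beta<1$ the Caputo derivative in space is $\partial_x^{\beta}u(x,t)=\frac{1}{\Gamma(1-\beta)}\int_0^x(x-y)^{-\beta}\frac{\partial}{\partial y}u(y,t)\,dy$. For $\alpha=1$ or $\beta=1$ these are the ordinary first-order partial derivatives. $W^{1,1}(0,T)$ is the space of $g\in L^1(0,T)$ with weak derivative in $L^1(0,T)$, and similarly for $W^{1,1}(0,\ell)$. The equation is understood to hold at every point $(x,t)\in Q_T$, with all derivatives occurring in it existing there (the integrals above being absolutely convergent). *)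

(* Defs.v *)
From HB Require Import structures.
From mathcomp Require Import all_boot all_order all_algebra.
From mathcomp Require Import all_classical all_reals all_analysis.

Set Implicit Arguments.
Unset Strict Implicit.
Unset Printing Implicit Defensive.

Import Order.TTheory GRing.Theory Num.Theory.
Import numFieldNormedType.Exports.

Local Open Scope classical_set_scope.
Local Open Scope ring_scope.

Definition Gamma {R : realType} (a : R) : R :=
  \int[lebesgue_measure]_(x in `]0, +oo[) (x `^ (a - 1) * expR (- x)).

Definition test_function {R : realType} (a b : R) (phi : R -> R) : Prop :=
  [/\ forall (k : nat) (x : R), derivable (derive1n k phi) x 1,
      compact (closure [set x | phi x != 0]) &
      closure [set x | phi x != 0] `<=` `]a, b[].

Definition L1 {R : realType} (a b : R) (f : R -> R) : Prop :=
  (@lebesgue_measure R).-integrable `]a, b[ (EFin \o f).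

Definition is_weak_derivative {R : realType} (a b : R) (f g : R -> R) : Prop :=
  forall phi : R -> R, test_function a b phi ->
    \int[lebesgue_measure]_(x in `]a, b[) (f x * derive1 phi x) =
    - \int[lebesgue_measure]_(x in `]a, b[) (g x * phi x).

Definition W11 {R : realType} (a b : R) (f : R -> R) : Prop :=
  L1 a b f /\ exists g, L1 a b g /\ is_weak_derivative a b f g.

(* A representative of the L^1 weak derivative; it is unique up to a null set,
   so the integrals below do not depend on the choice.  The value [cst 0] is
   only reached outside W^{1,1}. *)
Definition weak_derivative {R : realType} (a b : R) (f : R -> R) : R -> R :=
  xget (cst 0) [set g | L1 a b g /\ is_weak_derivative a b f g].

(* For f in W^{1,1}(0, L) the f' under the integral sign is the weak derivative;
   for order 1 the Caputo derivative is the classical one. *)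
Definition caputo_integrand {R : realType} (L gam : R) (f : R -> R) (t s : R)
    : R :=
  (t - s) `^ (- gam) * weak_derivative 0 L f s.

Definition caputo_exists {R : realType} (L gam : R) (f : R -> R) (t : R)
    : Prop :=
  if gam == 1 then derivable f t 1
  else L1 0 t (caputo_integrand L gam f t).

Definition caputo {R : realType} (L gam : R) (f : R -> R) (t : R) : R :=
  if gam == 1 then derive1 f t
  else (Gamma (1 - gam))^-1 *
       \int[lebesgue_measure]_(s in `]0, t[) caputo_integrand L gam f t s.

Definition caputo_t {R : realType} (T gam : R) (u : R * R -> R) (z : R * R)
    : R :=
  caputo T gam (fun s => u (z.1, s)) z.2.

Definition caputo_x {R : realType} (l gam : R) (u : R * R -> R) (z : R * R)
    : R :=
  caputo l gam (fun y => u (y, z.2)) z.1.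

Definition open_rect {R : realType} (l T : R) : set (R * R) :=
  `]0, l[ `*` `]0, T[.

Definition closed_rect {R : realType} (l T : R) : set (R * R) :=
  `[0, l] `*` `[0, T].

Definition initial_boundary {R : realType} (l T : R) : set (R * R) :=
  (`[0, l] `*` [set 0]) `|` ([set 0] `*` `[0, T]).

Definition is_max {R : realType} (A : set (R * R)) (u : R * R -> R) (M : R)
    : Prop :=
  (u @` A) M /\ ubound (u @` A) M.

Definition is_min {R : realType} (A : set (R * R)) (u : R * R -> R) (M : R)
    : Prop :=
  (u @` A) M /\ lbound (u @` A) M.

Definition frac_solution {R : realType} (l T : R) (n m : nat)
    (alpha : 'I_n -> R) (beta : 'I_m -> R)
    (p : 'I_n -> R * R -> R) (q : 'I_m -> R * R -> R)
    (r F u : R * R -> R) : Prop :=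
  forall z, open_rect l T z ->
    [/\ forall i, caputo_exists T (alpha i) (fun s => u (z.1, s)) z.2,
        forall j, caputo_exists l (beta j) (fun y => u (y, z.2)) z.1 &
        \sum_(i < n) p i z * caputo_t T (alpha i) u z +
        \sum_(j < m) q j z * caputo_x l (beta j) u z =
        r z * u z + F z].

(* Main.v *)
(** If the principle failed, then [u - eps * t] would, for small [eps], attain
    its maximum over some rectangle [[0, x0] * [0, t0]] with [x0 < l] and
    [t0 < T] at a point [(x, t)] off the initial boundary; hence the equation
    holds there, [u(x, s) <= u(x, t) - eps (t - s)] for [s <= t], and
    [u(y, t) <= u(x, t)] for [y <= x].  At such a one-sided maximum every Caputo
    derivative in [x] is nonnegative and every one in [t] is positive, which
    contradicts the sign of [r u + F].
    The inequality for the Caputo derivative of [f] at a maximum [t] over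
    [[0, t]] is
      [int_0^t (t - s)^-a f'(s) ds >= t^-a (f t - f 0) >= 0]:
    the kernel is increasing, hence [t^-a] plus a limit of positive combinations
    of indicators of intervals [(s, t)], on each of which [f'] integrates to
    [f t - f s >= 0].  That the weak derivative integrates to the increments of
    [f] is obtained by testing it against differences of smooth steps. *)

Require Import Defs.
From HB Require Import structures.
From mathcomp Require Import all_boot all_order all_algebra.
From mathcomp Require Import all_classical all_reals all_analysis.
From mathcomp Require Import measurable_realfun ring lra.

Import Order.TTheory GRing.Theory Num.Theory.
Import numFieldNormedType.Exports.

Local Open Scope classical_set_scope.
Local Open Scope ring_scope.

(** * Smooth steps *)

Section times_derivable.
Context {R : realType}.
Implicit Types f g : R -> R.

(** The recursion strips the innermost derivative, so the rules for sums, products and inverses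
    follow by induction on [k] with no Leibniz formula. The count is shifted: [times_derivable 0 f]
    already says that [f] is derivable. *)
Fixpoint times_derivable (k : nat) f : Prop :=
  (forall x, derivable f x 1) /\
  (if k is k'.+1 then times_derivable k' (derive1 f) else True).

Lemma times_derivable1 k f x : times_derivable k f -> derivable f x 1.
Proof. by case: k => [|k] [+ _]; apply. Qed.

Lemma times_derivableW k f : times_derivable k.+1 f -> times_derivable k f.
Proof.
elim: k f => [|k IH] f [df Hf]; split=> //; exact: IH.
Qed.

Lemma times_derivable_derive1n f :
  (forall k, times_derivable k f) ->
  forall k x, derivable (derive1n k f) x 1.
Proof.
move=> Hf k x; move: {Hf}(Hf k) => Hf.
elim: k f Hf => [|k IH] f [df Hf] //.
by rewrite /derive1n iterSr; exact: IH.
Qed.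

Lemma times_derivableD k f g : times_derivable k f -> times_derivable k g ->
  times_derivable k (f \+ g).
Proof.
elim: k f g => [|k IH] f g [df Hf] [dg Hg].
  by split=> [x|]; [exact: derivableD|].
split=> [x|]; first exact: derivableD.
rewrite (_ : derive1 _ = derive1 f \+ derive1 g); first exact: IH.
by apply/funext => x; rewrite derive1E deriveD// /= !derive1E.
Qed.

Lemma times_derivableM k f g : times_derivable k f -> times_derivable k g ->
  times_derivable k (f \* g).
Proof.
elim: k f g => [|k IH] f g Hf Hg.
  split=> [x|]; last by [].
  by apply: derivableM; [exact: times_derivable1 Hf|exact: times_derivable1 Hg].
split=> [x|].
  by apply: derivableM; [exact: times_derivable1 Hf|exact: times_derivable1 Hg].
rewrite (_ : derive1 _ = (f \* derive1 g) \+ (g \* derive1 f)).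
  apply: times_derivableD; apply: IH.
  - exact: times_derivableW.
  - by case: Hg.
  - exact: times_derivableW.
  - by case: Hf.
apply/funext => x; rewrite derive1E deriveM /= ?derive1E//.
  exact: times_derivable1 Hf.
exact: times_derivable1 Hg.
Qed.

Lemma times_derivableN k f : times_derivable k f -> times_derivable k (\- f).
Proof.
elim: k f => [|k IH] f [df Hf].
  by split=> [x|]; [exact: derivableN|].
split=> [x|]; first exact: derivableN.
rewrite (_ : derive1 _ = \- derive1 f); first exact: IH.
by apply/funext => x; rewrite derive1E deriveN// /= derive1E.
Qed.

Lemma times_derivableV k f : (forall x, f x != 0) ->
  times_derivable k f -> times_derivable k (fun x => (f x)^-1).
Proof.
move=> f0; elim: k => [|k IH] Hf.
  split=> [x|]; last by [].
  by apply: derivableV; [exact: f0|exact: times_derivable1 Hf].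
split=> [x|]; first by apply: derivableV; [exact: f0|exact: times_derivable1 Hf].
(* Written with two factors [(f x)^-1], the derivative is a product to which the induction
   hypothesis for the inverse applies. *)
rewrite (_ : derive1 _ = \- (((fun x => (f x)^-1) \* (fun x => (f x)^-1)) \* derive1 f)).
  apply/times_derivableN/times_derivableM; last by case: Hf.
  by apply: times_derivableM; apply: IH; exact: times_derivableW.
apply/funext => x; rewrite derive1E deriveV//; last exact: times_derivable1 Hf.
by rewrite /= derive1E -exprVn expr2 /GRing.scale/= mulNr.
Qed.

Lemma is_derive_shift f (c x df : R) : is_derive (x - c) 1 f df ->
  is_derive x 1 (fun y => f (y - c)) df.
Proof.
move=> Hf.
have H : is_derive x 1 (fun y : R => y - c) (1 - 0) by apply: is_deriveB.
have := @is_derive1_comp R f (fun y => y - c) _ _ _ Hf H.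
rewrite subr0 /GRing.scale/= mulr1; exact.
Qed.

Lemma is_derive_reflect f (c x df : R) : is_derive (c - x) 1 f df ->
  is_derive x 1 (fun y => f (c - y)) (- df).
Proof.
move=> Hf.
have H : is_derive x 1 (fun y : R => c - y) (0 - 1) by apply: is_deriveB.
have := @is_derive1_comp R f (fun y => c - y) _ _ _ Hf H.
rewrite sub0r /GRing.scale/= mulrN1; exact.
Qed.

Lemma times_derivable_shift k f c : times_derivable k f ->
  times_derivable k (fun x => f (x - c)).
Proof.
elim: k f => [|k IH] f [df Hf].
  split=> [x|]; last by [].
  by have [] := is_derive_shift f c x _ (DeriveDef (df _) erefl).
split=> [x|]; first by have [] := is_derive_shift f c x _ (DeriveDef (df _) erefl).
rewrite (_ : derive1 _ = fun x => derive1 f (x - c)); first exact: IH.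
apply/funext => x; rewrite !derive1E.
by case: (is_derive_shift f c x _ (DeriveDef (df _) erefl)).
Qed.

Lemma times_derivable_reflect k f c : times_derivable k f ->
  times_derivable k (fun x => f (c - x)).
Proof.
elim: k f => [|k IH] f [df Hf].
  split=> [x|]; last by [].
  by have [] := is_derive_reflect f c x _ (DeriveDef (df _) erefl).
split=> [x|]; first by have [] := is_derive_reflect f c x _ (DeriveDef (df _) erefl).
rewrite (_ : derive1 _ = \- (fun x => derive1 f (c - x))).
  by apply: times_derivableN; exact: IH.
apply/funext => x; rewrite /= !derive1E.
by case: (is_derive_reflect f c x _ (DeriveDef (df _) erefl)).
Qed.

End times_derivable.

(** * Smooth functions flat at the origin *)

Section flat.
Context {R : realType}.
Implicit Types p : {poly R}.

(* The span of the functions [P(1/x) exp(-1/x)] is closed under derivation. *)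
Definition flat p (x : R) : R := if 0 < x then p.[x^-1] * expR (- x^-1) else 0.

Lemma flat_le0 p x : x <= 0 -> flat p x = 0.
Proof. by rewrite /flat ltNge => ->. Qed.

Lemma horner_expRN_bounded p : exists2 C : R, 0 <= C &
  forall y, 0 <= y -> `|p.[y] * expR (- y)| <= C.
Proof.
exists (\sum_(i < size p) `|p`_i| * (i`!)%:R) => [|y y0].
  by apply: sumr_ge0 => i _; rewrite mulr_ge0.
rewrite horner_coef mulr_suml (le_trans (ler_norm_sum _ _ _))//.
apply: ler_sum => i _; rewrite -mulrA normrM ler_wpM2l//.
rewrite ger0_norm ?mulr_ge0 ?exprn_ge0 ?expR_ge0//.
rewrite expRN ler_pdivrMr ?expR_gt0//.
case: (nat_of_ord i) => [|k]; first by rewrite mul1r expr0 -expR0 ler_expR.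
have := expR_ge1Dxn k y0; have f0 : 0 < (k.+1`!)%:R :> R by rewrite ltr0n fact_gt0.
move=> H; rewrite mulrC -ler_pdivrMr//; apply: le_trans H; rewrite lerDr.
exact: ler01.
Qed.

(** For [x > 0] this is the chain rule applied to [P(1/x) exp(-1/x)]. At the origin the difference
    quotient is [O(h)], because a polynomial in [1/h] times [exp(-1/h)] stays bounded. *)
Lemma is_derive_flat p (x : R) : is_derive x 1 (flat p) (flat ('X^2 * (p - p^`())) x).
Proof.
have [x0|x0|->] := ltgtP x 0.
- rewrite (flat_le0 _ _ (ltW x0)).
  apply: (@near_eq_is_derive _ _ _ (cst (0:R))).
  by near=> y; rewrite flat_le0//; apply/ltW; near: y; exact: lt_nbhsl.
- have xV : is_derive x 1 (fun y : R => y^-1) (- x ^- 2 *: 1).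
    by apply: is_deriveV; rewrite gt_eqF.
  have d1 := @is_derive1_comp R (horner p) (fun y => y^-1) _ _ _ (is_derive_poly _ _) xV.
  have NxV := is_deriveN xV.
  have dE := is_derive_expR (- x^-1).
  have d2 := @is_derive1_comp R expR (fun y => - y^-1) _ _ _ dE NxV.
  have d3 := is_deriveM d1 d2.
  apply: (@near_eq_is_derive _ _ _
    ((horner p \o (fun y => y^-1)) * (expR \o (fun y => - y^-1)))).
    by near=> y; rewrite /flat ifT//; near: y; exact: lt_nbhsr.
  apply: is_derive_eq d3 _.
  rewrite /flat x0 !hornerE /GRing.scale/=.
  by field; rewrite gt_eqF.
rewrite (flat_le0 _ 0)//.
(* One power of [1/h] comes from the difference quotient; the second is inserted so that a factor
   [h] remains and forces the limit 0. *)
have [C C0 HC] := horner_expRN_bounded ('X^2 * p).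
suff H : h^-1 *: (flat p (h *: 1 + 0) - flat p 0) @[h --> 0^'] --> (0 : R).
  by split; [apply/cvg_ex; exists 0 | apply: cvg_lim].
rewrite (flat_le0 _ 0)//.
apply/cvgrPdist_le => e e0; near=> h.
rewrite sub0r normrN subr0 addr0 /GRing.scale/= mulr1 normrM.
have h0 : h != 0 by near: h; exact: nbhs_dnbhs_neq.
have [hle|hgt] := leP h 0; first by rewrite flat_le0// normr0 mulr0 ltW.
rewrite /flat hgt.
have := HC h^-1; rewrite invr_ge0 (ltW hgt) => /(_ isT).
rewrite !hornerE => H.
have -> : `|h^-1| * `|p.[h^-1] * expR (- h^-1)| =
    h * `|h^-1 ^+ 2 * p.[h^-1] * expR (- h^-1)|.
  rewrite -mulrA [in RHS]normrM normrX mulrA; congr (_ * _).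
  rewrite ger0_norm ?invr_ge0 ?ltW//; field; exact: h0.
apply: (@le_trans _ _ (h * C)); first by rewrite ler_wpM2l// ltW.
(* [C] may be 0; [C + 1] can safely divide [e]. *)
apply: (@le_trans _ _ (`|h| * (C + 1))).
  by rewrite (gtr0_norm hgt) ler_wpM2l ?lerDl// ltW.
rewrite -ler_pdivlMr ?ltr_wpDl//.
near: h; apply: dnbhs0_le; rewrite divr_gt0// ltr_wpDl//.
Unshelve. all: by end_near. Qed.

Lemma derive1_flat p : derive1 (flat p) = flat ('X^2 * (p - p^`())).
Proof. by apply/funext => x; rewrite derive1E; case: (is_derive_flat p x). Qed.

Lemma times_derivable_flat k p : times_derivable k (flat p).
Proof.
elim: k p => [|k IH] p; split=> //; try by move=> x; case: (is_derive_flat p x).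
by rewrite derive1_flat.
Qed.

End flat.

(** * Smooth monotone transitions from 0 to 1 *)

Section smooth_step.
Context {R : realType}.
Implicit Types S : R -> R.

(** The bounds on [S] supply the domination when limits are taken under the integral; the sign of
    [derive1 S] makes the derivative a density. *)
Definition is_step (c d : R) S : Prop :=
  [/\ forall k, times_derivable k S,
      forall x, x <= c -> S x = 0,
      forall x, d <= x -> S x = 1,
      forall x, 0 <= S x <= 1 &
      forall x, 0 <= derive1 S x].

(** The classical quotient [E(x - c) / (E(x - c) + E(d - x))] with [E(x) = exp(-1/x)] for [x > 0]
    and 0 elsewhere; since [c < d], the two terms of the denominator never vanish together. *)
Lemma smooth_step (c d : R) : c < d -> exists S, is_step c d S.
Proof.
move=> cd.
pose E : R -> R := flat 1.
have Egt0 x : 0 < x -> 0 < E x.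
  by move=> x0; rewrite /E /flat x0 hornerE mul1r expR_gt0.
have Ege0 x : 0 <= E x.
  by have [/flat_le0 E0|/Egt0/ltW//] := leP x 0; rewrite /E E0.
have dEge0 x : 0 <= derive1 E x.
  rewrite derive1_flat /flat; case: ifP => // x0.
  rewrite !hornerE derivC hornerC subr0 mulr1.
  by rewrite mulr_ge0 ?expR_ge0 ?exprn_ge0 ?invr_ge0 ?ltW.
pose A x := E (x - c); pose B x := E (d - x).
have AB0 x : A x + B x != 0.
  rewrite gt_eqF//; have [xc|cx] := leP x c.
    by apply: ltr_wpDl; [exact: Ege0|apply: Egt0; rewrite subr_gt0 (le_lt_trans xc)].
  by apply: ltr_pwDl; [apply: Egt0; rewrite subr_gt0|exact: Ege0].
have sA k : times_derivable k A by exact/times_derivable_shift/times_derivable_flat.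
have sB k : times_derivable k B by exact/times_derivable_reflect/times_derivable_flat.
exists (A \* (fun x => (A x + B x)^-1)); split.
- move=> k; apply: times_derivableM => //; apply: times_derivableV => //.
  exact: times_derivableD.
- by move=> x xc; rewrite /A/= /E flat_le0 ?mul0r// subr_le0.
- move=> x dx; rewrite /= (_ : B x = 0) ?addr0 ?divff//.
    by have := AB0 x; rewrite /B /E (flat_le0 1 (d - x)) ?subr_le0// addr0.
  by rewrite /B /E flat_le0 ?subr_le0.
- move=> x; rewrite mulr_ge0 ?invr_ge0 ?addr_ge0 ?Ege0//= ler_pdivrMr.
    by rewrite mul1r lerDl Ege0.
  by rewrite lt0r AB0 addr_ge0 ?Ege0.
- move=> x.
  have dE (y : R) : is_derive y 1 E (derive1 E y).
    rewrite derive1E; apply: DeriveDef => //.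
    exact: (times_derivable1 0 _ _ (times_derivable_flat 0 1)).
  have dA := is_derive_shift _ _ _ _ (dE (x - c)).
  have dB := is_derive_reflect _ _ _ _ (dE (d - x)).
  have dAB := is_deriveD dA dB.
  have dAV := is_deriveM dA (@is_deriveV R (A + B) _ _ _ (AB0 x) dAB).
  rewrite derive1E.
  have -> := @derive_val _ _ _ _ _ _ _ dAV.
  rewrite /GRing.scale/= -/(A x) -/(B x).
  have -> : (A + B) x = A x + B x by [].
  set a := A x; set b := B x; set a' := derive1 E (x - c); set b' := derive1 E (d - x).
  (* Over the common denominator the terms in [a * a'] cancel, leaving a numerator whose terms are
     all nonnegative. *)
  have -> : a * (- (a + b) ^- 2 * (a' - b')) + (a + b)^-1 * a' =
            (a' * b + a * b') / (a + b) ^+ 2.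
    by field; exact: AB0.
  apply: divr_ge0; first by apply: addr_ge0; apply: mulr_ge0; rewrite ?dEge0 ?Ege0.
  by rewrite exprn_ge0// addr_ge0 ?Ege0.
Qed.

End smooth_step.

(** * The fundamental theorem of calculus for weak derivatives *)

Section weak_derivative_FTC.
Context {R : realType}.
Notation mu := (@lebesgue_measure R).
Implicit Types f g S phi : R -> R.

Lemma Rintegral_dominated_cvg (D : set R) (f_ : nat -> R -> R) f g :
  measurable D -> (forall n, measurable_fun D (f_ n)) ->
  (forall x, D x -> f_ ^~ x @ \oo --> f x) ->
  mu.-integrable D (EFin \o g) ->
  (forall n x, D x -> `|f_ n x| <= g x) ->
  mu.-integrable D (EFin \o f) /\
  \int[mu]_(x in D) f_ n x @[n --> \oo] --> \int[mu]_(x in D) f x.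
Proof.
move=> mD mf_ f_f ig f_g.
have mf : measurable_fun D f by apply: (measurable_fun_cvg mf_).
have [||||intf _ H] := @dominated_convergence _ _ R mu D mD
    (fun n => EFin \o f_ n) (EFin \o f) (EFin \o g) _ _ _ ig.
- move=> n; apply/measurable_EFinP; exact: mf_.
- exact/measurable_EFinP.
- by apply: aeW => x Dx /=; apply: cvg_EFin; [exact: nearW|exact: f_f].
- by apply: aeW => x n Dx /=; rewrite lee_fin f_g.
split=> //; apply: fine_cvg.
by rewrite fineK//; exact: integrable_fin_num.
Qed.

Lemma derivable_continuous f : (forall x, derivable f x 1) -> continuous f.
Proof.
by move=> df x; apply/differentiable_continuous/derivable1_diffP.
Qed.

Lemma integrable_oo_continuous (a b : R) f : {within `[a, b], continuous f} ->
  mu.-integrable `]a, b[ (EFin \o f).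
Proof.
move=> cf.
have icf : mu.-integrable `[a, b] (EFin \o f).
  by apply: continuous_compact_integrable => //; exact: segment_compact.
by apply: integrableS icf => //; exact: subset_itv_oo_cc.
Qed.

(** The closure of the support lies in [[c, d]], and the strict margins place this segment inside
    the open interval. *)
Lemma test_function_itv (a b c d : R) phi :
  a < c -> d < b -> (forall k, times_derivable k phi) ->
  (forall x, x <= c -> phi x = 0) -> (forall x, d <= x -> phi x = 0) ->
  test_function a b phi.
Proof.
move=> ac db sphi phic phid.
have supp : closure [set x | phi x != 0] `<=` `[c, d].
  have /closure_id -> : closed (`[c, d] : set R) by exact: interval_closed.
  apply: closure_subset => x /=; apply: contraNP.
  rewrite in_itv/= => /negP; rewrite negb_and -!ltNge => /orP[] /ltW xcd.
    by rewrite phic.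
  by rewrite phid.
split.
- exact: times_derivable_derive1n.
- by apply: subclosed_compact supp; [exact: closed_closure|exact: segment_compact].
- apply: (subset_trans supp) => x /=; rewrite !in_itv/= => /andP[cx xd].
  by rewrite (lt_le_trans ac cx) (le_lt_trans xd db).
Qed.

Lemma derive1_step0 c d S x : is_step c d S -> x < c \/ d < x -> derive1 S x = 0.
Proof.
move=> [_ S0 S1 _ _] [xc|dx]; rewrite derive1E.
  rewrite (@near_eq_derive _ _ _ _ (cst 0)) ?derive_cst//.
  by near=> y; rewrite S0//; apply/ltW; near: y; exact: lt_nbhsl.
rewrite (@near_eq_derive _ _ _ _ (cst (1 : R))) ?derive_cst//.
by near=> y; rewrite S1//; apply/ltW; near: y; exact: lt_nbhsr.
Unshelve. all: by end_near. Qed.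

Lemma continuous_step c d S : is_step c d S -> continuous S.
Proof.
move=> [sS _ _ _ _]; apply: derivable_continuous => x.
exact: times_derivable1 (sS 0).
Qed.

Lemma continuous_derive1_step c d S : is_step c d S -> continuous (derive1 S).
Proof.
move=> [sS _ _ _ _]; apply: derivable_continuous => x.
by have [_ [+ _]] := sS 1; apply.
Qed.

Lemma integral_derive1_step (a b c d : R) S : is_step c d S ->
  a < c -> c < d -> d < b -> \int[mu]_(x in `]a, b[) derive1 S x = 1.
Proof.
move=> stS ac cd db; have ab : a < b by rewrite (lt_trans ac)// (lt_trans cd).
have cS' := continuous_derive1_step _ _ _ stS.
have cS := continuous_step _ _ _ stS.
rewrite /Rintegral -(integral_itv_bndoo true false); last first.
  apply/measurable_EFinP; apply: measurable_funTS.
  exact: continuous_measurable_fun.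
rewrite (@continuous_FTC2 _ _ S)//.
- by case: stS => _ S0 S1 _ _; rewrite (S0 _ (ltW ac)) (S1 _ (ltW db)) /= subr0.
- exact: continuous_subspaceT.
- case: stS => sS _ _ _ _; split.
  + by move=> x _; exact: times_derivable1 (sS 0).
  + by apply: cvg_at_right_filter; exact: cS.
  + by apply: cvg_at_left_filter; exact: cS.
Qed.

(* [derive1 S] is a probability density supported in [[c, d]]. *)
Lemma integral_mul_step_near (a b c d e : R) f S : is_step c d S ->
  a < c -> c < d -> d < b -> {within `[a, b], continuous f} ->
  (forall x, c <= x <= d -> `|f x - f c| <= e) ->
  `|\int[mu]_(x in `]a, b[) (f x * derive1 S x) - f c| <= e.
Proof.
move=> stS ac cd db cf fe; have ab : a < b by rewrite (lt_trans ac)// (lt_trans cd).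
have cS' := continuous_derive1_step _ _ _ stS.
have cS'w : {within `[a, b], continuous (derive1 S)} by exact: continuous_subspaceT.
have iS' := integrable_oo_continuous a b _ cS'w.
have ifS : mu.-integrable `]a, b[ (EFin \o (fun x => f x * derive1 S x)).
  by apply: integrable_oo_continuous => x; apply: continuousM; [exact: cf|exact: cS'w].
have icS r : mu.-integrable `]a, b[ (EFin \o (fun x => r * derive1 S x)).
  exact: (@integrableZl _ _ _ mu _ _ r _ iS').
have S1 := integral_derive1_step _ _ _ _ _ stS ac cd db.
have <- : \int[mu]_(x in `]a, b[) (f c * derive1 S x) = f c.
  by rewrite RintegralZl// S1 mulr1.
rewrite -RintegralB//.
have iB : mu.-integrable `]a, b[
    (EFin \o (fun x => f x * derive1 S x - f c * derive1 S x)).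
  by have := @integrableB _ _ _ mu _ _ _ _ ifS (icS (f c)); apply.
apply: (le_trans (le_normr_Rintegral _ iB)) => //.
have -> : e = \int[mu]_(x in `]a, b[) (e * derive1 S x) by rewrite RintegralZl// S1 mulr1.
apply: le_Rintegral => //; first exact: integrable_norm iB.
move=> x _; rewrite -mulrBl normrM [`|derive1 S x|]ger0_norm; last by case: stS.
have [cx|xc] := leP c x; last first.
  by rewrite (derive1_step0 _ _ _ _ stS (or_introl xc)) !mulr0.
have [xd|dx] := leP x d; last first.
  by rewrite (derive1_step0 _ _ _ _ stS (or_intror dx)) !mulr0.
by rewrite ler_wpM2r ?fe ?cx//; case: stS.
Qed.

Lemma steps_near (s b : R) : s < b -> exists (d : nat -> R) (S : nat -> R -> R),
  [/\ forall n, s < d n < b, d @ \oo --> s & forall n, is_step s (d n) (S n)].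
Proof.
(* The denominators start at 2, so that [d n < b] holds already for [n = 0]. *)
move=> sb; pose d n := s + (b - s) * (n.+2%:R)^-1.
have bs0 : 0 < b - s by rewrite subr_gt0.
have dP n : s < d n < b.
  rewrite /d ltrDl mulr_gt0 ?invr_gt0//=.
  by rewrite -ltrBrDl ltr_pdivrMr// ltr_pMr// ltr1n.
have /choice[S HS] n : exists S, is_step s (d n) S.
  by have /andP[sd _] := dP n; exact: smooth_step.
exists d, S; split=> //.
rewrite -[X in _ --> X]addr0; apply: cvgD; first exact: cvg_cst.
rewrite -(mulr0 (b - s)); apply: cvgM; first exact: cvg_cst.
have := @cvg_harmonic R; rewrite -(cvg_shiftS (@harmonic R)); exact.
Qed.

(** The derivatives of the steps form an approximate identity: densities carried by the shrinking
    segments [[s, d n]]. *)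
Lemma cvg_integral_mul_derive1_step (a b s : R) f d (S : nat -> R -> R) :
  a < s -> (forall n, s < d n < b) -> d @ \oo --> s ->
  (forall n, is_step s (d n) (S n)) -> {within `[a, b], continuous f} ->
  \int[mu]_(x in `]a, b[) (f x * derive1 (S n) x) @[n --> \oo] --> f s.
Proof.
move=> as_ dP ds stS cf.
have sb : s < b by have /andP[h1 h2] := dP 0; exact: lt_trans h2.
have ab : a < b by exact: lt_trans sb.
have cfs : {for s, continuous f}.
  by have [+ _ _] := proj1 (continuous_within_itvP f ab) cf; apply; rewrite in_itv/= as_.
apply/cvgrPdist_le => e e0.
have /cvgrPdist_le/(_ _ e0)/nbhs_ballP[r /= r0 Hr] := cfs.
near=> n.
have /andP[sd db] := dP n.
rewrite distrC; apply: (integral_mul_step_near _ _ _ _ _ _ _ (stS n)) => // x /andP[sx xd].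
rewrite distrC; apply: Hr; rewrite /ball/= ltr_distlC; apply/andP; split.
  by rewrite ltrBlDr (le_lt_trans sx)// ltrDl.
rewrite (le_lt_trans xd)//; near: n.
by apply: cvgr_lt ds _ _; rewrite ltrDl.
Unshelve. all: by end_near. Qed.

(** The steps converge pointwise to the indicator of [x > s], the value at [s] itself being always
    0, and the products are dominated by [|g|]. *)
Lemma cvg_integral_mul_step (a b s : R) g d (S : nat -> R -> R) :
  a <= s -> d @ \oo --> s -> (forall n, is_step s (d n) (S n)) -> L1 a b g ->
  \int[mu]_(x in `]a, b[) (g x * S n x) @[n --> \oo] -->
  \int[mu]_(x in `]s, b[) g x.
Proof.
move=> as_ ds stS ig.
have <- : `]a, b[ `&` `]s, b[ = `]s, b[%classic.
  by apply: setIidr; apply: subset_itvr; rewrite bnd_simp.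
rewrite Rintegral_mkcondr.
have mg : measurable_fun `]a, b[ g by apply/measurable_EFinP; exact: measurable_int ig.
have [|||||_ //] := @Rintegral_dominated_cvg `]a, b[%classic (fun n x => g x * S n x)
  (g \_ `]s, b[%classic) (fun x => `|g x|).
- by [].
- move=> n; apply: measurable_funM => //; apply: measurable_funTS.
  by apply: continuous_measurable_fun; apply: (continuous_step _ _ _ (stS n)).
- move=> x; rewrite /= in_itv/= => /andP[ax xb].
  rewrite patchE; case: ifPn => [|xsb].
    rewrite inE/= in_itv/= => /andP[sx _]; apply: cvg_near_cst; near=> n.
    have [_ _ S1 _ _] := stS n; rewrite S1 ?mulr1//.
    by apply/ltW; near: n; exact: cvgr_lt ds _ sx.
  have xs : x <= s.
    by rewrite leNgt; apply: contra xsb => sx; rewrite inE/= in_itv/= sx.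
  rewrite (_ : (fun n => _) = cst 0); first exact: cvg_cst.
  by apply/funext => n; have [_ S0 _ _ _] := stS n; rewrite S0 ?mulr0.
- exact: integrable_norm ig.
- move=> n x _; have [_ _ _ /(_ x)/andP[S0 S1] _] := stS n.
  by rewrite normrM [`|S n x|]ger0_norm// ler_piMr.
Unshelve. all: by end_near. Qed.

(** A single step equals 1 up to [b] and is no test function, but the difference of a step at [s]
    and a step at [t] is one. Writing both sides with tails up to [b] separates the two points, so
    that each side is the limit of an expression in one family of steps. *)
Lemma weak_derivative_FTC_interior (a b s t : R) f g :
  {within `[a, b], continuous f} -> L1 a b g -> is_weak_derivative a b f g ->
  a < s < b -> a < t < b ->
  f s + \int[mu]_(x in `]s, b[) g x = f t + \int[mu]_(x in `]t, b[) g x.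
Proof.
move=> cf ig fg /andP[as_ sb] /andP[at_ tb].
have [d [S [dP ds stS]]] := steps_near s b sb.
have [d' [S' [d'P d't stS']]] := steps_near t b tb.
have Fs := cvg_integral_mul_derive1_step _ _ _ _ _ _ as_ dP ds stS cf.
have Ft := cvg_integral_mul_derive1_step _ _ _ _ _ _ at_ d'P d't stS' cf.
have Gs := cvg_integral_mul_step _ _ _ _ _ _ (ltW as_) ds stS ig.
have Gt := cvg_integral_mul_step _ _ _ _ _ _ (ltW at_) d't stS' ig.
have Hs : \int[mu]_(x in `]a, b[) (f x * derive1 (S n) x) +
    \int[mu]_(x in `]a, b[) (g x * S n x) @[n --> \oo] -->
    f s + \int[mu]_(x in `]s, b[) g x by exact: cvgD Fs Gs.
have Ht : \int[mu]_(x in `]a, b[) (f x * derive1 (S' n) x) +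
    \int[mu]_(x in `]a, b[) (g x * S' n x) @[n --> \oo] -->
    f t + \int[mu]_(x in `]t, b[) g x by exact: cvgD Ft Gt.
have mg : measurable_fun `]a, b[ g by apply/measurable_EFinP; exact: measurable_int ig.
have ifS c e (P : R -> R) : is_step c e P ->
    mu.-integrable `]a, b[ (EFin \o (fun x => f x * derive1 P x)).
  move=> stP; apply: integrable_oo_continuous => x; apply: continuousM; first exact: cf.
  by apply: continuous_subspaceT; exact: continuous_derive1_step stP.
have igS c e (P : R -> R) : is_step c e P ->
    mu.-integrable `]a, b[ (EFin \o (fun x => g x * P x)).
  move=> stP; apply: le_integrable ig => //.
    apply/measurable_EFinP/measurable_funM => //; apply: measurable_funTS.
    by apply: continuous_measurable_fun; apply: (continuous_step _ _ _ stP).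
  move=> x _; have [_ _ _ /(_ x)/andP[P0 P1] _] := stP.
  by rewrite /= lee_fin normrM [`|P x|]ger0_norm// ler_piMr.
have arith (x y z w : R) : x - y = - (z - w) -> x + z = y + w by lra.
suff E n : \int[mu]_(x in `]a, b[) (f x * derive1 (S n) x) +
    \int[mu]_(x in `]a, b[) (g x * S n x) =
    \int[mu]_(x in `]a, b[) (f x * derive1 (S' n) x) +
    \int[mu]_(x in `]a, b[) (g x * S' n x).
  move: Hs; under eq_fun do rewrite E; move=> Hs.
  exact: (cvg_unique (@norm_hausdorff _ R) Hs Ht).
have [sS S0 S1 _ _] := stS n; have [sS' S'0 S'1 _ _] := stS' n.
have Hphi : test_function a b (S n \+ \- S' n).
  apply: (@test_function_itv a b (Num.min s t) (Num.max (d n) (d' n))).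
  - by rewrite lt_min as_ at_.
  - by have /andP[_ ?] := dP n; have /andP[_ ?] := d'P n; rewrite gt_max; apply/andP.
  - by move=> k; apply: times_derivableD => //; exact: times_derivableN.
  - by move=> x; rewrite le_min => /andP[? ?] /=; rewrite S0// S'0// subr0.
  - by move=> x; rewrite ge_max => /andP[? ?] /=; rewrite S1// S'1// subrr.
have := fg _ Hphi.
have -> : derive1 (S n \+ \- S' n) = fun x => derive1 (S n) x - derive1 (S' n) x.
  apply/funext => x; rewrite !derive1E deriveB//.
    exact: times_derivable1 (sS 0%N).
  exact: times_derivable1 (sS' 0%N).
under eq_Rintegral do rewrite mulrBr.
under [in X in _ = - X -> _]eq_Rintegral do rewrite mulrBr.
rewrite !RintegralB//; last 4 first.
- exact: igS (stS n). - exact: igS (stS' n).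
- exact: ifS (stS n). - exact: ifS (stS' n).
exact: arith.
Qed.

(** The Caputo integral starts at the endpoint, so [s = a] has to be included: there the interior
    identity is carried to the limit along points [d n] decreasing to [a] in value, by continuity of
    [f] and dominated convergence for the tails. Splitting the tail at [t] then gives the
    increment. *)
Lemma weak_derivative_FTC (a b s t : R) f g :
  {within `[a, b], continuous f} -> L1 a b g -> is_weak_derivative a b f g ->
  a <= s -> s <= t -> a < t < b ->
  \int[mu]_(x in `]s, t[) g x = f t - f s.
Proof.
move=> cf ig fg as_ st /[dup] atb /andP[at_ tb].
have sb : s < b by exact: le_lt_trans tb.
have ab : a < b by exact: lt_trans tb.
have mg : measurable_fun `]a, b[ g by apply/measurable_EFinP; exact: measurable_int ig.
have H : f s + \int[mu]_(x in `]s, b[) g x = f t + \int[mu]_(x in `]t, b[) g x.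
  move: as_; rewrite le_eqVlt => /orP[/eqP <-|as_]; last first.
    by apply: (weak_derivative_FTC_interior a b); rewrite ?as_.
  have [d [_ [dP da _]]] := steps_near a b ab.
  have [_ fa _] := (continuous_within_itvP f ab).1 cf.
  have fd : f (d n) @[n --> \oo] --> f a.
    move/cvg_at_rightP : fa; apply; split=> // n; have /andP[] := dP n; by [].
  have Gd : \int[mu]_(x in `]d n, b[) g x @[n --> \oo] --> \int[mu]_(x in `]a, b[) g x.
    have E n : `]a, b[ `&` `]d n, b[ = `]d n, b[%classic.
      have /andP[/ltW adn _] := dP n.
      by apply: setIidr; apply: subset_itvr; rewrite bnd_simp.
    under eq_fun do rewrite -E Rintegral_mkcondr.
    have [|||||_ //] := @Rintegral_dominated_cvg `]a, b[%classic
      (fun n => g \_ `]d n, b[%classic)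
      g (fun x => `|g x|).
    - by [].
    - move=> n; apply/measurable_restrict => //; rewrite E.
      by apply: measurable_funS mg => //; rewrite -E; exact: subIsetl.
    - move=> x; rewrite /= in_itv/= => /andP[ax xb]; apply: cvg_near_cst; near=> n.
      rewrite patchE ifT// inE/= in_itv/= xb andbT; near: n; exact: cvgr_lt da _ ax.
    - exact: integrable_norm ig.
    - by move=> n x _; rewrite patchE; case: ifPn => // _; rewrite normr0.
  apply: (cvg_unique (@norm_hausdorff _ R) (cvgD fd Gd)) => //.
  apply: cvg_near_cst; near=> n; rewrite fctE.
  exact: (weak_derivative_FTC_interior a b).
have ist : mu.-integrable `]s, b[ (EFin \o g).
  by apply: integrableS ig => //; apply: subset_itvr; rewrite bnd_simp.
have := @Rintegral_itvB R g (BRight s) (BLeft b) t ist.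
rewrite !bnd_simp => /(_ st tb).
rewrite -Rintegral_itv_bndo_bndc; first by lra.
by apply: integrableS ist => //; apply: subset_itvl; rewrite bnd_simp ltW.
Unshelve. all: by end_near. Qed.

End weak_derivative_FTC.

(** * Monotone weights *)

Section monotone_weight.
Context {R : realType}.
Notation mu := (@lebesgue_measure R).
Implicit Types K g : R -> R.

(* The sum is [min (M, floor z)]. *)
Lemma sum_le_indicatorE (M : nat) (z : R) : 0 <= z ->
  let c : R := \sum_(i < M) (i.+1%:R <= z)%R%:R in
  if M%:R <= z then c = M%:R else z - 1 <= c <= z.
Proof.
move=> z0; elim: M => [|M IH]; first by rewrite /= big_ord0 z0.
rewrite /= big_ord_recr/=.
have [Mz|zM] := leP M.+1%:R z.
  by move: IH => /=; rewrite ifT ?(le_trans _ Mz) ?ler_nat// => ->; rewrite -natrD addn1.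
rewrite [false%:R]mulr0n addr0; move: IH => /=; case: ifPn => // Mz ->.
by rewrite Mz andbT; move: zM; rewrite -natr1; lra.
Qed.

(** For nondecreasing [K] a nonempty upper level set is an interval from its infimum [s] to [b],
    with or without [s]. This gives measurability, and the point [s] does not affect the
    integral. *)
Lemma integral_upper_level_ge0 (a b c : R) K g : a < b ->
  {in `]a, b[ &, {homo K : x y / x <= y}} -> L1 a b g ->
  (forall s, a <= s < b -> 0 <= \int[mu]_(x in `]s, b[) g x) ->
  measurable (`]a, b[ `&` [set x | c <= K x]) /\
  0 <= \int[mu]_(x in `]a, b[ `&` [set x | c <= K x]) g x.
Proof.
move=> ab homoK ig g0; set J := _ `&` _.
have [J0|/set0P[x0 Jx0]] := eqVneq J set0.
  by rewrite J0 Rintegral_set0; split.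
have Jlb : lbound J a by move=> x [/=]; rewrite in_itv/= => /andP[/ltW].
have infJ : has_inf J by split; [exists x0|exists a].
pose s := inf J.
have as_ : a <= s by apply: lb_le_inf => //; exists x0.
have sJ x : J x -> s <= x by apply: ge_inf; exists a.
have sb : s < b.
  by apply: le_lt_trans (sJ _ Jx0) _; move: Jx0 => [/=]; rewrite in_itv/= => /andP[].
have Js x : s < x -> x < b -> J x.
  move=> sx xb; have xab : x \in `]a, b[ by rewrite in_itv/= xb (le_lt_trans as_).
  have [y [/= yab cy] yx] : exists2 y, J y & y < x by apply: inf_lt => //; exists x0.
  by split=> //=; apply: le_trans cy _; apply: homoK => //; exact: ltW.
have isb : mu.-integrable `]s, b[ (EFin \o g).
  by apply: integrableS ig => //; apply: subset_itvr; rewrite bnd_simp.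
have gs : 0 <= \int[mu]_(x in `]s, b[) g x by apply: g0; rewrite as_.
have Jxb x : J x -> x < b by move=> [/=]; rewrite in_itv/= => /andP[].
have [Jss|Jss] := pselect (J s).
  have -> : J = `[s, b[%classic.
    apply/seteqP; split=> x /=; rewrite in_itv/=.
      by move=> Jx; rewrite sJ// Jxb.
    move=> /andP[]; rewrite le_eqVlt => /orP[/eqP <- //|]; exact: Js.
  by split; [exact: measurable_itv|rewrite -Rintegral_itv_obnd_cbnd].
have -> : J = `]s, b[%classic.
  apply/seteqP; split=> x /=; rewrite in_itv/=.
    move=> Jx; rewrite Jxb// andbT lt_neqAle sJ// andbT.
    by apply/eqP => sx; apply: Jss; rewrite sx.
  by move=> /andP[]; exact: Js.
by split; [exact: measurable_itv|].
Qed.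

(** Induction on the number of levels; integrability is carried along since splitting off the last
    level uses additivity of the integral. *)
Lemma integral_sum_upper_level_ge0 (a b : R) K g (c : nat -> R) (M : nat) : a < b ->
  {in `]a, b[ &, {homo K : x y / x <= y}} -> L1 a b g ->
  (forall s, a <= s < b -> 0 <= \int[mu]_(x in `]s, b[) g x) ->
  L1 a b (fun x => (\sum_(i < M) (c i <= K x)%R%:R) * g x) /\
  0 <= \int[mu]_(x in `]a, b[) ((\sum_(i < M) (c i <= K x)%R%:R) * g x).
Proof.
move=> ab homoK ig g0; elim: M => [|M [IH1 IH2]].
  rewrite /L1 (_ : (fun x => _) = cst 0); last first.
    by apply/funext => x; rewrite big_ord0 mul0r.
  by split; [exact: integrable0|rewrite Rintegral_cst// mul0r].
have [] := integral_upper_level_ge0 a b (c M) K g ab homoK ig g0.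
set J := _ `&` _ => mJ J0.
have E x : x \in `]a, b[%classic ->
    (\sum_(i < M.+1) (c i <= K x)%R%:R) * g x =
    (\sum_(i < M) (c i <= K x)%R%:R) * g x + (g \_ J) x.
  rewrite inE => xab; rewrite big_ord_recr/= mulrDl patchE; congr (_ + _).
  have [cK|cK] := boolP (c M <= K x); first by rewrite mul1r mem_set.
  by rewrite mul0r memNset// => -[_ /=]; apply/negP.
have IJ : `]a, b[ `&` J = J by rewrite /J setIA setIid.
have iM : mu.-integrable `]a, b[ (EFin \o (g \_ J)).
  rewrite -restrict_EFin; apply/integrable_restrict => //; rewrite IJ.
  by apply: integrableS ig => //; exact: subIsetl.
split.
  apply: (@eq_integrable _ _ _ mu _ _
    (EFin \o (fun x => (\sum_(i < M) (c i <= K x)%R%:R) * g x + (g \_ J) x))) => //.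
    by move=> x xab /=; rewrite E.
  by have := @integrableD _ _ _ mu _ _ _ _ IH1 iM; apply.
by rewrite (eq_Rintegral mu E) RintegralD// addr_ge0// -Rintegral_mkcondr IJ.
Qed.

(** A layer-cake argument: the roundings of [K] lie between 0 and [K], so [|K g|] dominates, and
    nonnegativity passes to the limit. *)
Lemma integral_nondecreasing_mul_ge0 (a b : R) K g : a < b ->
  {in `]a, b[, forall x, 0 <= K x} ->
  {in `]a, b[ &, {homo K : x y / x <= y}} -> L1 a b g ->
  L1 a b (fun x => K x * g x) ->
  (forall s, a <= s < b -> 0 <= \int[mu]_(x in `]s, b[) g x) ->
  0 <= \int[mu]_(x in `]a, b[) (K x * g x).
Proof.
move=> ab K0 homoK ig iKg g0.
(* [h N x / (N + 1)] is [K x] rounded down to a multiple of [1 / (N + 1)], for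
   [N] large: a combination of indicators of upper level sets of [K]. *)
pose h N x := \sum_(i < N.+1 ^ 2) (i.+1%:R / N.+1%:R <= K x)%R%:R : R.
pose KN N x := N.+1%:R^-1 * (h N x * g x).
have hE N x : h N x = \sum_(i < N.+1 ^ 2) (i.+1%:R <= K x * N.+1%:R)%R%:R.
  by apply: eq_bigr => i _; rewrite ler_pdivrMr.
have hP N := integral_sum_upper_level_ge0 a b K g (fun i => i.+1%:R / N.+1%:R)
  (N.+1 ^ 2) ab homoK ig g0.
have ih N : mu.-integrable `]a, b[ (EFin \o (fun x => h N x * g x)).
  by have [] := hP N.
have hle N x : x \in `]a, b[ -> h N x <= K x * N.+1%:R.
  move=> xab; have := @sum_le_indicatorE (N.+1 ^ 2) (K x * N.+1%:R).
  rewrite mulr_ge0 ?K0// => /(_ isT); rewrite /= -hE.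
  by case: ifPn => [H -> //|_ /andP[]].
have [|||||_ H] := @Rintegral_dominated_cvg R `]a, b[%classic KN (fun x => K x * g x)
   (fun x => `|K x * g x|).
- by [].
- move=> N; apply: measurable_funM => //; apply/measurable_EFinP.
  exact: measurable_int (ih N).
- move=> x xab; rewrite /KN.
  under eq_fun do rewrite mulrA.
  apply: cvgM; last exact: cvg_cst.
  apply/cvgrPdist_le => e e0; near=> N.
  have N0 : 0 < N.+1%:R :> R by [].
  have := @sum_le_indicatorE (N.+1 ^ 2) (K x * N.+1%:R).
  rewrite mulr_ge0 ?K0// => /(_ isT); rewrite /= -hE natrX expr2 ler_pM2r//.
  (* The [N.+1 ^ 2] levels with spacing [1 / N.+1] reach height [N.+1]; once this exceeds [K x], the
     sum is not cut off at [x] and the rounding error is at most [1 / N.+1]. *)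
  have KN1 : K x < N.+1%:R.
    near: N; apply: filterS (nbhs_infty_gtr (K x)) => N KxN.
    by rewrite (lt_trans KxN)// ltr_nat.
  rewrite leNgt KN1/= => /andP[h1 h2].
  have Ve : N.+1%:R^-1 <= e.
    by apply: ltW; near: N; exact: (near_infty_natSinv_lt (PosNum e0)).
  rewrite ler_distlC; apply/andP; split.
    rewrite (@le_trans _ _ (K x - N.+1%:R^-1))// ?lerD2l ?lerN2//.
    by rewrite -(ler_pM2l N0) mulrBr mulrA !divff// ?mul1r ?gt_eqF// mulrC.
  by apply: (@le_trans _ _ (K x)); [rewrite ler_pdivrMl// mulrC|rewrite lerDl ltW].
- exact: integrable_norm iKg.
- move=> N x xab; rewrite /KN mulrA !normrM ler_wpM2r//.
  rewrite !ger0_norm ?K0 ?invr_ge0//; last by apply: sumr_ge0 => i _.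
  by rewrite ler_pdivrMl// mulrC hle.
rewrite -(cvg_lim _ H)//; apply: limr_ge; first by apply/cvg_ex; eexists; exact: H.
apply: nearW => N.
rewrite RintegralZl// mulr_ge0 ?invr_ge0//.
by have [] := hP N.
Unshelve. all: by end_near. Qed.

End monotone_weight.

(** * The Caputo kernel as a monotone weight *)

Section kernel.
Context {R : realType}.
Notation mu := (@lebesgue_measure R).
Implicit Types g : R -> R.

(** The difference of the two sides is the integral of [g] against [(t - s)^-gam - t^-gam], a
    nonnegative nondecreasing weight on [(0, t)]. *)
Lemma ge_integral_kernel (t gam : R) g : 0 < t -> 0 <= gam -> L1 0 t g ->
  L1 0 t (fun s => (t - s) `^ (- gam) * g s) ->
  (forall s, 0 <= s < t -> 0 <= \int[mu]_(x in `]s, t[) g x) ->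
  t `^ (- gam) * \int[mu]_(s in `]0, t[) g s <=
  \int[mu]_(s in `]0, t[) ((t - s) `^ (- gam) * g s).
Proof.
move=> t0 gam0 ig ikg g0.
have ic : mu.-integrable `]0, t[ (EFin \o (fun s => t `^ (- gam) * g s)).
  exact: (@integrableZl _ _ _ mu _ _ _ _ ig).
rewrite -RintegralZl// -subr_ge0 -RintegralB//.
have kle x y : 0 < x -> x <= y -> y `^ (- gam) <= x `^ (- gam).
  move=> x0 xy; rewrite !powRN lef_pV2 ?posrE ?powR_gt0//; last exact: lt_le_trans xy.
  by rewrite ge0_ler_powR// nnegrE ltW// (lt_le_trans x0).
under eq_Rintegral do rewrite -mulrBl.
apply: (@integral_nondecreasing_mul_ge0 _ _ _
  (fun s => (t - s) `^ (- gam) - t `^ (- gam))) => //.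
- move=> s; rewrite in_itv/= => /andP[s0 st].
  by rewrite subr_ge0 kle ?subr_gt0// gerBl ltW.
- move=> x y; rewrite !in_itv/= => /andP[x0 xt] /andP[y0 yt] xy.
  by rewrite lerD2r kle ?subr_gt0// lerD2l lerN2.
- rewrite (_ : (fun _ => _) = fun s => (t - s) `^ (- gam) * g s - t `^ (- gam) * g s).
    by have := @integrableB _ _ _ mu _ _ _ _ ikg ic; apply.
  by apply/funext => s; rewrite mulrBl.
Qed.

End kernel.

(** * Positivity of the Gamma function *)

Section Gamma_pos.
Context {R : realType}.
Notation mu := (@lebesgue_measure R).

(** The antiderivative [x^a / a] gives a bound independent of [c], which survives the limit
    [c -> 0]. *)
Lemma integral_powR_itv (a c : R) : 0 < a -> 0 < c < 1 ->
  (\int[mu]_(x in `[c, 1%R]) (x `^ (a - 1))%:E <= (a^-1)%:E)%E.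
Proof.
move=> a0 /andP[c0 c1].
have dP (x : R) : 0 < x -> is_derive x 1 (fun x : R => a^-1 * x `^ a) (x `^ (a - 1)).
  move=> x0.
  have := @is_deriveZ _ _ _ _ a^-1 _ _ _ (is_derive1_powR a x0).
  move=> H; apply: is_derive_eq H _.
  by rewrite /GRing.scale/= mulrA mulVf ?mul1r// gt_eqF.
have cP b (x : R) : 0 < x -> {for x, continuous (fun y : R => y `^ b)}.
  move=> x0; apply/differentiable_continuous/derivable1_diffP.
  by have [] := is_derive1_powR b x0.
rewrite (@continuous_FTC2 _ _ (fun x : R => a^-1 * x `^ a))//.
- by rewrite powR1 mulr1 -EFinB lee_fin gerBl mulr_ge0 ?powR_ge0// invr_ge0 ltW.
- apply: continuous_in_subspaceT => x; rewrite inE/= in_itv/= => /andP[cx _].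
  by apply: cP; exact: lt_le_trans cx.
- split.
  + move=> x; rewrite in_itv/= => /andP[cx _].
    by have [] := dP x (lt_trans c0 cx).
  + by apply: cvg_at_right_filter; apply: cvgM; [exact: cvg_cst|exact: cP].
  + by apply: cvg_at_left_filter; apply: cvgM; [exact: cvg_cst|exact: cP].
- move=> x; rewrite in_itv/= => /andP[cx _]; rewrite derive1E.
  by have [] := dP x (lt_trans c0 cx).
Qed.

Lemma integrable_powR_itv01 (a : R) : 0 < a ->
  mu.-integrable `]0, 1] (EFin \o (fun x => x `^ (a - 1))).
Proof.
move=> a0; apply/integrableP; split.
  by apply/measurable_EFinP/measurable_funTS; exact: measurable_powR.
(* Exhaustion for monotone convergence; [n.+2] keeps every left end strictly below 1. *)
have -> : `]0, 1]%classic = \bigcup_n `[(n.+2%:R^-1 : R), 1]%classic.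
  apply/seteqP; split=> x /=.
    rewrite in_itv/= => /andP[x0 x1].
    have [N _ HN] := near_infty_natSinv_lt (PosNum x0).
    exists N => //=; rewrite in_itv/= x1 andbT ltW//.
    by have := HN N.+1 (leqnSn N).
  move=> [n _] /=; rewrite !in_itv/= => /andP[nx ->]; rewrite andbT.
  by rewrite (lt_le_trans _ nx).
apply: (@le_lt_trans _ _ (a^-1)%:E); last exact: ltry.
have cvgF := @ge0_nondecreasing_set_cvg_integral _ (measurableTypeR R) R
  (fun n => `[(n.+2%:R^-1 : R), 1%R]%classic)
  (fun x => `|(x `^ (a - 1))%:E|)%E mu.
have mF n : measurable_fun `[(n.+2%:R^-1 : R), 1] (fun x : R => `|(x `^ (a - 1))%:E|)%E.
  apply: measurableT_comp => //; apply/measurable_EFinP/measurable_funTS.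
  exact: measurable_powR.
rewrite -(cvg_lim _ (cvgF _ _ _ _))//.
- apply: lime_le.
    apply/cvg_ex; eexists; apply: cvgF => //.
    move=> m n mn; apply/subsetPset => x /=; rewrite !in_itv/= => /andP[mx ->].
    by rewrite andbT (le_trans _ mx)// lef_pV2 ?posrE// ler_nat !ltnS.
  apply: nearW => n.
  under eq_integral do rewrite gee0_abs ?lee_fin ?powR_ge0//.
  apply: integral_powR_itv => //.
  by rewrite invr_gt0 ltr0n/= invf_lt1// ltr1n.
- move=> m n mn; apply/subsetPset => x /=; rewrite !in_itv/= => /andP[mx ->].
  by rewrite andbT (le_trans _ mx)// lef_pV2 ?posrE// ler_nat !ltnS.
Qed.

(** Integrability comes first, because the real-valued integral of a nonnegative function with
    infinite integral would be 0. After that, a positive lower bound on the part over [(1, 2)]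
    suffices. *)
Lemma Gamma_gt0 (a : R) : 0 < a <= 1 -> 0 < Gamma a.
Proof.
move=> /andP[a0 a1].
pose f (x : R) := x `^ (a - 1) * expR (- x).
have f0 x : 0 <= f x by rewrite mulr_ge0 ?powR_ge0 ?expR_ge0.
have mf D : measurable_fun D f.
  apply: measurable_funTS; apply: measurable_funM; first exact: measurable_powR.
  by apply: measurableT_comp => //; exact: measurable_funN.
(* The dominating function: the power controls the integrand on [(0, 1]], the exponential density
   controls it beyond 1. *)
pose G (x : R) := ((fun y : R => y `^ (a - 1)) \_ `]0, 1]%classic) x + exponential_pdf 1 x.
have iG : mu.-integrable `]0, +oo[ (EFin \o G).
  have i1 : mu.-integrable `]0, +oo[
      (EFin \o ((fun y : R => y `^ (a - 1)) \_ `]0, 1]%classic)).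
    rewrite -restrict_EFin; apply/integrable_restrict => //.
    rewrite (_ : _ `&` _ = `]0, 1]%classic); first exact: integrable_powR_itv01.
    by apply: setIidr; apply: subset_itvl; rewrite bnd_simp.
  have i2 : mu.-integrable `]0, +oo[ (EFin \o exponential_pdf 1).
    by apply: integrableS (@integrable_exponential_pdf R 1 ltr01) => //.
  by have := @integrableD _ _ _ mu _ _ _ _ i1 i2; apply.
have fG x : `]0, +oo[%classic x -> f x <= G x.
  rewrite /= in_itv/= andbT => x0; rewrite /f /G patchE (exponential_pdfE _ (ltW x0)).
  rewrite mul1r mulN1r; case: ifPn => [_|].
    apply: (@le_trans _ _ (x `^ (a - 1))); last by rewrite lerDl expR_ge0.
    by rewrite ler_piMr ?powR_ge0// expR_le1 oppr_le0 ltW.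
  rewrite notin_setE/= in_itv/= x0/= => /negP; rewrite -ltNge => x1.
  rewrite add0r ler_piMl ?expR_ge0//.
  by rewrite -[leRHS](powRr0 x) ler_powR ?(ltW x1)// subr_le0.
have if_ : mu.-integrable `]0, +oo[ (EFin \o f).
  apply: le_integrable iG => //; first by apply/measurable_EFinP; exact: mf.
  by move=> x xD; rewrite lee_fin !ger0_norm ?fG// (le_trans (f0 x))// fG.
have sub12 : `]1, 2[ `<=` (`]0, +oo[ : set R).
  by move=> x /=; rewrite !in_itv/= andbT => /andP[+ _]; exact: lt_trans.
have if12 : mu.-integrable `]1, 2[ (EFin \o f) by apply: integrableS if_.
(* Since [a <= 1], both factors of the integrand are nonincreasing, so the value at 2 bounds it from
   below on [(1, 2)]. *)
pose c : R := 2 `^ (a - 1) * expR (- 2).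
have c0 : 0 < c by rewrite mulr_gt0 ?powR_gt0 ?expR_gt0.
have m12 : mu `]1, 2[ = 1%:E.
  by rewrite lebesgue_measure_itv/= lte_fin ltr1n/= -EFinB; congr EFin; ring.
have cf : c <= \int[mu]_(x in `]1, 2[) f x.
  have -> : c = \int[mu]_(x in `]1, 2[) c.
    by rewrite Rintegral_cst// [X in fine X]m12 mulr1.
  apply: le_Rintegral => //.
    apply: measurable_bounded_integrable => //.
    - by have : (mu `]1%R, 2%R[ < +oo)%E by rewrite m12 ltry.
    - exact: (bounded_cst c).
  move=> x; rewrite /= in_itv/= => /andP[x1 x2].
  have x0 : 0 < x by exact: lt_trans x1.
  rewrite ler_pM ?powR_ge0 ?expR_ge0//; last by rewrite ler_expR lerN2 ltW.
  rewrite -opprB !powRN lef_pV2 ?posrE ?powR_gt0//.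
  by rewrite ge0_ler_powR ?subr_ge0// ?nnegrE ltW.
apply: (lt_le_trans c0); apply: (le_trans cf).
rewrite /Gamma /Rintegral fine_le ?integrable_fin_num//.
apply: ge0_subset_integral => //; first by apply/measurable_EFinP; exact: mf.
by move=> x _; rewrite lee_fin.
Qed.

End Gamma_pos.

(** * Caputo derivatives at a one-sided extremum *)

Section caputo_extremum.
Context {R : realType}.
Notation mu := (@lebesgue_measure R).
Implicit Types f : R -> R.

(** The derivative is also the limit of the quotients with [h < 0]; the growth hypothesis at [t + h]
    bounds the numerator by [e * h], and division by the negative [h] reverses the inequality. *)
Lemma le_derive1_left_growth f (t b e sigma : R) : 0 < t -> derivable f t 1 ->
  (forall s, 0 <= s <= t -> sigma * f s <= sigma * f t - e * (t - s)) ->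
  e <= sigma * derive1 f t.
Proof.
move=> t0 df H.
have /cvg_dnbhs_at_left Dl : h^-1 *: (f (h *: 1 + t) - f t) @[h --> 0^'] --> derive1 f t.
  by rewrite derive1E; exact: df.
have sDl : sigma * (h^-1 *: (f (h *: 1 + t) - f t)) @[h --> 0^'-] --> sigma * derive1 f t.
  by apply: cvgM; [exact: cvg_cst|exact: Dl].
rewrite -(cvg_lim _ sDl)//; apply: limr_ge; first by apply/cvg_ex; eexists; exact: sDl.
near=> h.
have h0 : h < 0 by near: h; exact: nbhs_left_lt.
have th : - t < h by near: h; apply: nbhs_left_gt; rewrite oppr_lt0.
rewrite /GRing.scale/= mulr1.
have := H (h + t); rewrite -lerBlDr sub0r (ltW th) gerDr (ltW h0) => /(_ isT) Hh.
rewrite mulrCA mulrC ler_ndivlMr// mulrBr; lra.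
Unshelve. all: by end_near. Qed.

(* With [e = 0] this gives nonnegativity, with [0 < e] positivity; the factor
   [sigma = 1] treats maxima of [f] and [sigma = -1] minima. *)
Lemma caputo_extremum (L gam t e sigma : R) f :
  {within `[0, L], continuous f} -> W11 0 L f -> 0 < gam <= 1 -> 0 < t < L ->
  caputo_exists L gam f t ->
  (forall s, 0 <= s <= t -> sigma * f s <= sigma * f t - e * (t - s)) ->
  0 <= e ->
  exists2 c, 0 < c & c * e <= sigma * caputo L gam f t.
Proof.
move=> cf [_ Wf] /andP[gam0 gam1] /[dup] t0L /andP[t0 tL]; rewrite /caputo_exists /caputo.
case: ifPn => [_ df fs e0|gamN1 ik fs e0].
  by exists 1 => //; rewrite mul1r; exact: le_derive1_left_growth.
(* Membership in [W11] provides a weak derivative, so the choice does not fall back on the default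
   [cst 0]. *)
have [ig fg] := xgetPex (cst 0) Wf; rewrite -/(weak_derivative 0 L f) in ig fg.
set g := weak_derivative 0 L f in ig fg.
have gam_lt1 : gam < 1 by rewrite lt_neqAle gamN1.
have ig0t : L1 0 t g.
  by apply: integrableS ig => //; apply: subset_itvl; rewrite bnd_simp ltW.
have igs s : 0 <= s -> mu.-integrable `]s, t[ (EFin \o g).
  by move=> s0; apply: integrableS ig0t => //; apply: subset_itvr; rewrite bnd_simp.
have FTC s : 0 <= s -> s <= t ->
    \int[mu]_(x in `]s, t[) (sigma * g x) = sigma * f t - sigma * f s.
  move=> s0 st; rewrite RintegralZl//; last exact: igs.
  by rewrite (weak_derivative_FTC _ _ _ _ _ _ cf ig fg) ?mulrBr.
have iZ h : L1 0 t h -> L1 0 t (fun x => sigma * h x).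
  by move=> ih; exact: (@integrableZl _ _ _ mu _ _ sigma _ ih).
have kE : \int[mu]_(s in `]0, t[) ((t - s) `^ (- gam) * (sigma * g s)) =
    sigma * \int[mu]_(s in `]0, t[) caputo_integrand L gam f t s.
  rewrite -RintegralZl//; apply: eq_Rintegral => s _.
  by rewrite /caputo_integrand mulrCA.
have K := @ge_integral_kernel R t gam (fun x => sigma * g x) t0 (ltW gam0) (iZ _ ig0t).
have G0 : 0 < Gamma (1 - gam) by apply: Gamma_gt0; rewrite subr_gt0 gam_lt1 gerBl ltW.
(* The kernel inequality bounds the integral below by [t^-gam] times the increment of [sigma * f]
   over [[0, t]], and the growth hypothesis at [s = 0] makes that increment at least [e * t]. *)
exists ((Gamma (1 - gam))^-1 * (t `^ (- gam) * t)).
  by rewrite mulr_gt0 ?invr_gt0// mulr_gt0 ?powR_gt0.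
rewrite [leRHS]mulrCA -!mulrA ler_wpM2l ?invr_ge0 ?(ltW G0)// -kE.
apply: (@le_trans _ _ (t `^ (- gam) * \int[mu]_(x in `]0, t[) (sigma * g x))).
  rewrite ler_wpM2l ?powR_ge0// FTC ?(ltW t0)//.
  have := fs 0; rewrite lexx (ltW t0) subr0 => /(_ isT); lra.
apply: K.
  rewrite (_ : (fun _ => _) = fun s => sigma * caputo_integrand L gam f t s).
    exact: iZ.
  by apply/funext => s; rewrite /caputo_integrand mulrCA.
move=> s /andP[s0 st]; rewrite FTC ?(ltW st)// subr_ge0.
have := fs s; rewrite s0 (ltW st) => /(_ isT)/le_trans; apply.
by rewrite gerBl mulr_ge0// subr_ge0 ltW.
Qed.

End caputo_extremum.

(** * The maximum principle *)

Lemma within_continuous_comp {X Y Z : topologicalType} (A : set X) (B : set Y)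
  (j : X -> Y) (f : Y -> Z) : continuous j -> (forall x, A x -> B (j x)) ->
  {within B, continuous f} -> {within A, continuous (f \o j)}.
Proof.
move=> cj jAB /subspace_continuousP cf; apply/subspace_continuousP => x Ax.
apply: cvg_comp (cf _ (jAB _ Ax)) => U; rewrite /nbhs/= => BU.
have := cj x _ BU; rewrite /nbhs/=; apply: filterS => y jy Ay; exact: jy (jAB _ Ay).
Qed.

(** * Extrema of continuous functions on the rectangle *)

Section rectangle.
Context {R : realType} (l T : R).
Hypotheses (l_gt0 : 0 < l) (T_gt0 : 0 < T).
Variable w : R * R -> R.
Hypothesis w_cont : {within closed_rect l T, continuous w}.

Lemma compact_closed_rect : compact (closed_rect l T).
Proof. by apply: compact_setX; exact: segment_compact. Qed.

Lemma compact_initial_boundary : compact (@initial_boundary R l T).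
Proof.
by apply: compactU; apply: compact_setX; try exact: segment_compact; exact: compact_set1.
Qed.

Lemma initial_boundary_sub : initial_boundary l T `<=` closed_rect l T.
Proof.
move=> [x t] [] [/=]; rewrite /closed_rect/= !in_itv/=.
  by move=> -> ->; rewrite lexx ltW.
by move=> -> ->; rewrite lexx ltW.
Qed.

Lemma ex_is_max (A : set (R * R)) : A `<=` closed_rect l T -> A !=set0 -> compact A ->
  exists M, is_max A w M.
Proof.
move=> AR A0 cA.
have [c cA' Hc] := compact_EVT_max A0 cA (continuous_subspaceW AR w_cont).
exists (w c); split; first by exists c => //; rewrite inE in cA'.
by move=> _ [z Az <-]; apply: Hc; rewrite inE.
Qed.

Lemma ex_max_rect : exists M, is_max (closed_rect l T) w M.
Proof.
apply: ex_is_max => //; last exact: compact_closed_rect.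
by exists (0, 0); rewrite /closed_rect/=; split; rewrite /= in_itv/= lexx ltW.
Qed.

Lemma ex_max_initial_boundary : exists M, is_max (initial_boundary l T) w M.
Proof.
apply: ex_is_max; [exact: initial_boundary_sub| |exact: compact_initial_boundary].
by exists (0, 0); left; split=> //=; rewrite in_itv/= lexx ltW.
Qed.

(** The equation says nothing on the sides [x = l] and [t = T]; continuity along the segment from
    [z] to the centre of the rectangle moves the violation inside. *)
Lemma gt_closed_rect_open_rect (K : R) (z : R * R) : closed_rect l T z -> K < w z ->
  exists2 z', open_rect l T z' & K < w z'.
Proof.
case: z => x t [/=]; rewrite !in_itv/= => /andP[x0 xl] /andP[t0 tT] Kw.
pose j (s : R) : R * R := (x + s * (l / 2 - x), t + s * (T / 2 - t)).
have cj : continuous j.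
  have ca (y d s : R) : y + s' * d @[s' --> s] --> y + s * d.
    by apply: cvgD; [exact: cvg_cst|apply: cvgM; [exact: cvg_id|exact: cvg_cst]].
  by move=> s; exact: (cvg_pair (ca _ _ _) (ca _ _ _)).
have jin (L y s : R) : 0 < L -> 0 <= y -> y <= L -> 0 < s -> s < 1 ->
    0 < y + s * (L / 2 - y) < L.
  move=> L0 y0 yL s0 s1; apply/andP; split; nra.
have jR s : `[0, 1]%classic s -> closed_rect l T (j s).
  rewrite /= in_itv/= => /andP[s0 s1].
  split; rewrite /= in_itv/=; apply/andP; split; nra.
have := within_continuous_comp _ _ _ _ cj jR w_cont.
move=> /(continuous_within_itvP _ ltr01).1[_ + _].
rewrite [(w \o j) 0]/= /j !mul0r !addr0 => wj.
have Kj : \forall s \near 0^'+, K < (w \o j) s by exact: cvgr_gt wj _ Kw.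
near (0:R)^'+ => s.
have s0 : 0 < s by near: s; exact: nbhs_right_gt.
have s1 : s < 1 by near: s; exact: nbhs_right_lt.
exists (j s); last by near: s.
by split; rewrite /= in_itv/=; apply: jin.
Unshelve. all: by end_near. Qed.

Lemma ex_max_tilted (K : R) : (forall z, initial_boundary l T z -> w z <= K) ->
  (exists2 z, closed_rect l T z & K < w z) ->
  exists e x t, [/\ 0 < e, 0 < x < l, 0 < t < T, K < w (x, t) &
    (forall s, 0 <= s <= t -> w (x, s) <= w (x, t) - e * (t - s)) /\
    (forall y, 0 <= y <= x -> w (y, t) <= w (x, t))].
Proof.
move=> wK [z Rz Kz].
have [[x0 t0] [/=]] := gt_closed_rect_open_rect K z Rz Kz.
rewrite !in_itv/= => /andP[x00 x0l] /andP[t00 t0T] Kw.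
(* With this slope the tilt at [t0] costs exactly half of the excess of [w (x0, t0)] over [K], so
   the tilted function still exceeds [K] there, and so does [w] at the maximum point. *)
pose e := (w (x0, t0) - K) / (2 * t0).
have e0 : 0 < e by rewrite divr_gt0 ?subr_gt0// mulr_gt0.
have et0 : e * t0 = (w (x0, t0) - K) / 2 by rewrite /e; field; rewrite gt_eqF.
pose v z := w z - e * z.2.
have sub : closed_rect x0 t0 `<=` closed_rect l T.
  move=> [x t] [/=]; rewrite !in_itv/= => /andP[? xx0] /andP[? tt0].
  by split; rewrite /= in_itv/=; apply/andP; split=> //; apply/ltW;
    [apply: le_lt_trans x0l|apply: le_lt_trans t0T].
have cv : {within closed_rect x0 t0, continuous v}.
  have cw := continuous_subspaceW sub w_cont.
  move=> y; apply: cvgB; first exact: cw.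
  apply: (continuous_subspaceT (f := fun z : R * R => e * z.2)).
  by move=> z'; apply: cvgM; [exact: cvg_cst|exact: cvg_snd].
have R00 : closed_rect x0 t0 !=set0.
  by exists (x0, t0); split; rewrite /= in_itv/= lexx ltW.
(* The maximum is taken over the rectangle with corner [(x0, t0)], which avoids [x = l] and [t = T]
   and contains all points to the left of or before the maximum point. *)
have [[x t]] := compact_EVT_max R00
  (compact_setX (@segment_compact _ 0 x0) (@segment_compact _ 0 t0)) cv.
rewrite inE => -[/=]; rewrite !in_itv/= => /andP[x_ge0 xx0] /andP[t_ge0 tt0] vmax.
have {}vmax y s : 0 <= y <= x0 -> 0 <= s <= t0 -> w (y, s) - e * s <= w (x, t) - e * t.
  by move=> hy hs; apply: (vmax (y, s)); rewrite inE; split; rewrite /= in_itv/=.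
have Kxt : K < w (x, t).
  have := vmax x0 t0; rewrite !lexx (ltW x00) (ltW t00) => /(_ isT isT).
  by have := mulr_ge0 (ltW e0) t_ge0; rewrite et0; lra.
have nb : ~ initial_boundary l T (x, t) by move=> /wK; rewrite leNgt Kxt.
have xl : x < l by exact: le_lt_trans x0l.
have tT : t < T by exact: le_lt_trans t0T.
exists e, x, t; split=> //.
- rewrite xl andbT lt0r x_ge0 andbT; apply/eqP => x_0; apply: nb; right.
  by split=> //=; rewrite in_itv/= t_ge0 ltW.
- rewrite tT andbT lt0r t_ge0 andbT; apply/eqP => t_0; apply: nb; left.
  by split=> //=; rewrite in_itv/= x_ge0 ltW.
split.
- move=> s /andP[s0 st]; have := vmax x s.
  rewrite x_ge0 xx0 s0 (le_trans st)// => /(_ isT isT).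
  lra.
- move=> y /andP[y0 yx]; have := vmax y t.
  rewrite t_ge0 tt0 y0 (le_trans yx)// => /(_ isT isT).
  lra.
Qed.

End rectangle.

(** * Contradiction with the equation at the tilted maximum *)

Section weak_maximum.
Context {R : realType} (l T : R) (n m : nat).
Variables (alpha : 'I_n -> R) (beta : 'I_m -> R).
Variables (p : 'I_n -> R * R -> R) (q : 'I_m -> R * R -> R) (r F u : R * R -> R).
Hypotheses (l_gt0 : 0 < l) (T_gt0 : 0 < T).
Hypothesis alpha_bnd : forall i, 0 < alpha i <= 1.
Hypothesis beta_bnd : forall j, 0 < beta j <= 1.
Hypothesis p_ge0 : forall i z, open_rect l T z -> 0 <= p i z.
Hypothesis q_ge0 : forall j z, open_rect l T z -> 0 <= q j z.
Hypothesis p_sum_gt0 : forall z, open_rect l T z -> 0 < \sum_(i < n) p i z.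
Hypothesis u_cont : {within closed_rect l T, continuous u}.
Hypothesis u_W11_x : forall t, 0 < t < T -> W11 0 l (fun x => u (x, t)).
Hypothesis u_W11_t : forall x, 0 < x < l -> W11 0 T (fun t => u (x, t)).
Hypothesis u_sol : frac_solution l T alpha beta p q r F u.

(** The factor [sigma] is 1 for maxima and -1 for minima. The sign of the right-hand side is
    requested only where [sigma * u] exceeds [K], so that [K] may be chosen to control the sign of
    [u] in the term [r * u]. *)
Lemma signed_maximum_principle (sigma K : R) :
  (forall z, initial_boundary l T z -> sigma * u z <= K) ->
  (forall z, open_rect l T z -> K < sigma * u z -> sigma * (r z * u z + F z) <= 0) ->
  forall z, closed_rect l T z -> sigma * u z <= K.
Proof.
move=> bK rF z Rz; rewrite leNgt; apply/negP => Kz.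
have w_cont : {within closed_rect l T, continuous (fun z => sigma * u z)}.
  by move=> y; apply: cvgM; [exact: cvg_cst|exact: u_cont].
have [e [x [t [e0 xl tT Kxt [Ht Hx]]]]] := ex_max_tilted l T l_gt0 T_gt0
  (fun z => sigma * u z) w_cont K bK (ex_intro2 _ _ z Rz Kz).
have Oxt : open_rect l T (x, t) by split; rewrite /= in_itv/=.
have [dt dx eqn] := u_sol _ Oxt.
have /andP[x0 xltl] := xl; have /andP[t0 tltT] := tT.
have ut_cont : {within `[0, T], continuous (fun s => u (x, s))}.
  apply: (within_continuous_comp _ _ (fun s => (x, s)) u) u_cont.
    by move=> s; exact: (cvg_pair (cvg_cst _) cvg_id).
  by move=> s sT; split=> //=; rewrite in_itv/= !ltW.
have ux_cont : {within `[0, l], continuous (fun y => u (y, t))}.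
  apply: (within_continuous_comp _ _ (fun y => (y, t)) u) u_cont.
    by move=> y; exact: (cvg_pair cvg_id (cvg_cst _)).
  by move=> y yl; split=> //=; rewrite in_itv/= !ltW.
have Dt i : 0 < sigma * caputo_t T (alpha i) u (x, t).
  have [c c0] := caputo_extremum T (alpha i) t e sigma _ ut_cont (u_W11_t _ xl)
    (alpha_bnd i) tT (dt i) Ht (ltW e0).
  by apply: lt_le_trans; rewrite mulr_gt0.
have Dx j : 0 <= sigma * caputo_x l (beta j) u (x, t).
  have [|c c0] := caputo_extremum l (beta j) x 0 sigma _ ux_cont (u_W11_x _ tT)
    (beta_bnd j) xl (dx j) _ (lexx 0); last by rewrite mulr0.
  by move=> y yx; rewrite mul0r subr0; exact: Hx.
have := rF _ Oxt Kxt; rewrite -eqn mulrDr !mulr_sumr.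
have q0 : 0 <= \sum_(j < m) sigma * (q j (x, t) * caputo_x l (beta j) u (x, t)).
  apply: sumr_ge0 => j _; rewrite mulrCA.
  by apply: mulr_ge0; [exact: q_ge0|exact: Dx].
have p0 : 0 < \sum_(i < n) sigma * (p i (x, t) * caputo_t T (alpha i) u (x, t)).
  have pge i : 0 <= sigma * (p i (x, t) * caputo_t T (alpha i) u (x, t)).
    by rewrite mulrCA; apply: mulr_ge0; [exact: p_ge0|exact: ltW (Dt i)].
  (* A vanishing sum of nonnegative terms would make every [p i (x, t)] zero, as the time
     derivatives are strictly positive after multiplication by [sigma]; this contradicts the
     positivity of the sum of the [p i]. *)
  rewrite lt0r sumr_ge0// andbT.
  have := p_sum_gt0 _ Oxt; rewrite lt0r => /andP[+ _]; apply: contra_neq => /eqP.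
  rewrite psumr_eq0// => /allP H; apply: big1 => i _.
  have := H i (mem_index_enum i); rewrite mulrCA mulf_eq0 (gt_eqF (Dt i)) orbF.
  by move/eqP.
lra.
Qed.

Lemma maximum_principle (K : R) :
  (forall z, initial_boundary l T z -> u z <= K) ->
  (forall z, open_rect l T z -> K < u z -> r z * u z + F z <= 0) ->
  forall z, closed_rect l T z -> u z <= K.
Proof.
move=> bK rF z Rz; rewrite -[u z]mul1r; apply: signed_maximum_principle => //.
  by move=> y; rewrite mul1r; exact: bK.
by move=> y; rewrite !mul1r; exact: rF.
Qed.

Lemma minimum_principle (K : R) :
  (forall z, initial_boundary l T z -> K <= u z) ->
  (forall z, open_rect l T z -> u z < K -> 0 <= r z * u z + F z) ->
  forall z, closed_rect l T z -> K <= u z.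
Proof.
move=> bK rF z Rz; rewrite -lerN2 -mulN1r; apply: signed_maximum_principle => //.
  by move=> y yb; rewrite mulN1r lerN2; exact: bK.
by move=> y yo; rewrite !mulN1r ltrN2 oppr_le0; exact: rF.
Qed.

End weak_maximum.

Lemma is_min_opp {R : realType} (A : set (R * R)) (u : R * R -> R) M :
  is_max A (\- u) M -> is_min A u (- M).
Proof.
move=> [[z Az uz] uM]; split; first by exists z => //; rewrite -uz opprK.
by move=> _ [y Ay <-]; rewrite lerNl; apply: uM; exists y.
Qed.

Theorem theorem3p1 (R : realType) (l T : R) (l_gt0 : 0 < l) (T_gt0 : 0 < T)
  (n m : nat) (n_ge1 : (1 <= n)%N) (m_ge1 : (1 <= m)%N)
  (alpha : 'I_n -> R) (beta : 'I_m -> R)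
  (alpha_bnd : forall i, 0 < alpha i <= 1)
  (alpha_incr : forall i j : 'I_n, (i < j)%N -> alpha i < alpha j)
  (beta_bnd : forall j, 0 < beta j <= 1)
  (beta_incr : forall i j : 'I_m, (i < j)%N -> beta i < beta j)
  (p : 'I_n -> R * R -> R) (q : 'I_m -> R * R -> R) (r F : R * R -> R)
  (p_cont : forall i, {within closed_rect l T, continuous (p i)})
  (q_cont : forall j, {within closed_rect l T, continuous (q j)})
  (r_cont : {within closed_rect l T, continuous r})
  (F_cont : {within closed_rect l T, continuous F})
  (p_ge0 : forall i z, open_rect l T z -> 0 <= p i z)
  (q_ge0 : forall j z, open_rect l T z -> 0 <= q j z)
  (p_sum_gt0 : forall z, closed_rect l T z -> 0 < \sum_(i < n) p i z)
  (r_le0 : forall z, closed_rect l T z -> r z <= 0)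
  (u : R * R -> R)
  (u_cont : {within closed_rect l T, continuous u})
  (u_W11_x : forall t, 0 < t < T -> W11 0 l (fun x => u (x, t)))
  (u_W11_t : forall x, 0 < x < l -> W11 0 T (fun t => u (x, t)))
  (u_sol : frac_solution l T alpha beta p q r F u) :
  [/\ (forall z, closed_rect l T z -> F z <= 0) ->
        exists M M0 : R, [/\ is_max (closed_rect l T) u M,
          is_max (initial_boundary l T) u M0 & M <= Num.max 0 M0],
      (forall z, closed_rect l T z -> 0 <= F z) ->
        exists M M0 : R, [/\ is_min (closed_rect l T) u M,
          is_min (initial_boundary l T) u M0 & Num.min 0 M0 <= M] &
      (forall z, open_rect l T z -> r z = 0) ->
        ((forall z, closed_rect l T z -> F z <= 0) ->
          exists M M0 : R, [/\ is_max (closed_rect l T) u M,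
            is_max (initial_boundary l T) u M0 & M = M0]) /\
        ((forall z, closed_rect l T z -> 0 <= F z) ->
          exists M M0 : R, [/\ is_min (closed_rect l T) u M,
            is_min (initial_boundary l T) u M0 & M = M0])].
Proof.
have OR z : open_rect l T z -> closed_rect l T z.
  by move=> [h1 h2]; split; exact: subset_itv_oo_cc.
have IR := @initial_boundary_sub R l T l_gt0 T_gt0.
have max_le := maximum_principle l T n m alpha beta p q r F u l_gt0 T_gt0
  alpha_bnd beta_bnd p_ge0 q_ge0 (fun z Oz => p_sum_gt0 z (OR z Oz))
  u_cont u_W11_x u_W11_t u_sol.
have min_ge := minimum_principle l T n m alpha beta p q r F u l_gt0 T_gt0
  alpha_bnd beta_bnd p_ge0 q_ge0 (fun z Oz => p_sum_gt0 z (OR z Oz))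
  u_cont u_W11_x u_W11_t u_sol.
have [M Mmax] := ex_max_rect l T l_gt0 T_gt0 u u_cont.
have [M0 M0max] := ex_max_initial_boundary l T l_gt0 T_gt0 u u_cont.
(* The minima of [u] are obtained as the negatives of the maxima of [- u]. *)
have Nu_cont : {within closed_rect l T, continuous (\- u)}.
  by move=> y; apply: cvgN; exact: u_cont.
have [N' /is_min_opp] := ex_max_rect l T l_gt0 T_gt0 _ Nu_cont.
set N := - N' => Nmin.
have [N0' /is_min_opp] := ex_max_initial_boundary l T l_gt0 T_gt0 _ Nu_cont.
set N0 := - N0' => N0min.
have M0ub z : initial_boundary l T z -> u z <= M0.
  by move=> bz; apply: M0max.2; exists z.
have N0lb z : initial_boundary l T z -> N0 <= u z.
  by move=> bz; apply: N0min.2; exists z.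
have M0M : M0 <= M by case: M0max.1 => z /IR Rz <-; apply: Mmax.2; exists z.
have NN0 : N <= N0 by case: N0min.1 => z /IR Rz <-; apply: Nmin.2; exists z.
split=> [F0|F0|r0].
(* Here [K = max 0 M0]: where [u] exceeds it, [u] is positive and [r * u <= 0]. *)
- exists M, M0; split=> //; have [zM RzM <-] := Mmax.1; apply: max_le => // z.
    by move=> bz; rewrite le_max M0ub ?orbT.
  move=> Oz; rewrite gt_max => /andP[uz _]; have Rz := OR z Oz.
  by rewrite -[leRHS](addr0 0) lerD ?F0// mulr_le0_ge0 ?r_le0// ltW.
- exists N, N0; split=> //; have [zM RzM <-] := Nmin.1; apply: min_ge => // z.
    by move=> bz; rewrite ge_min N0lb ?orbT.
  move=> Oz; rewrite lt_min => /andP[uz _]; have Rz := OR z Oz.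
  by rewrite addr_ge0 ?F0// mulr_le0 ?r_le0// ltW.
split=> F0.
(* With [r = 0] the sign of [u] is irrelevant and [K = M0] itself is admissible; the inclusion of
   the initial boundary in the rectangle gives the other inequality. *)
- exists M, M0; split=> //; apply/eqP; rewrite eq_le M0M andbT.
  have [zM RzM <-] := Mmax.1; apply: max_le => // z Oz _.
  by rewrite r0// mul0r add0r; exact/F0/OR.
- exists N, N0; split=> //; apply/eqP; rewrite eq_le NN0/=.
  have [zM RzM <-] := Nmin.1; apply: min_ge => // z Oz _.
  by rewrite r0// mul0r add0r; exact/F0/OR.
Qed.
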